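(* Let $G$ be a graph with maximal vertex degree $\Delta_G$, number of vertices $|G|$, and first non-trivial (smallest non-zero) Laplace eigenvalue $\lambda_G$. Then $$\mathrm{sgon}(G)\geq \left\lceil \frac{\lambda_G}{\lambda_G+4(\Delta_G+1)}\,|G| \right \rceil.$$
   Context: Graphs are finite and connected; multiple edges and loops are allowed. For a graph $G$, $V(G)$ and $E(G)$ are its sets of vertices and edges, $|G|=|V(G)|$, $E(x,y)$ is the set of edges joining $x$ and $y$, and $E_v(G)$ is the set of edges incident to $v$. The degree $d_v$ of a vertex is the number of edges incident to it, loops counted twice; $\Delta_G=\max_v d_v$. A tree is a connected graph with $|E|-|V|+1=0$. A graph $G'$ is a refinement of $G$ if it is obtained from $G$ by performing finitely many times one of the operations: (1) subdivision of an edge; (2) addition of a leaf, i.e. of an extra vertex and an edge between this vertex and an already existing vertex. The Laplacian is $L_G=D_G-A_G$, with $D_G$ the diagonal matrix of vertex degrees and $A_G$ the adjacency matrix, whose $(x,y)$-entry is $|E(x,y)|$ (loops counted twice on the diagonal, as in the degree, so that constant functions are in the kernel). It is positive semidefinite with eigenvalue $0$ of multiplicity one; $\lambda_G$ is its smallest non-zero eigenvalue (defined when $|G|\ge 2$). Let $G,G'$ be loopless graphs. A finite morphism $\varphi:G\to G'$ is a map $V(G)\cup E(G)\to V(G')\cup E(G')$ with $\varphi(V(G))\subset V(G')$ and $\varphi(e)\in E(\varphi(x),\varphi(y))$ for every $e\in E(x,y)$, together with a positive integer $r_\varphi(e)$ (the index) for each $e\in E(G)$. It is harmonic if for every $v\in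 V(G)$ there is a well-defined number $m_\varphi(v)$ such that $m_\varphi(v)=\sum_{e\in E_v(G),\,\varphi(e)=e'}r_\varphi(e)$ for every $e'\in E_{\varphi(v)}(G')$ (if $E_{\varphi(v)}(G')=\emptyset$, then $m_\varphi(v)$ may be chosen to be any positive integer). The degree of a finite harmonic morphism is $\deg\varphi=\sum_{v\in\varphi^{-1}(v')}m_\varphi(v)=\sum_{e\in\varphi^{-1}(e')}r_\varphi(e)$, which is independent of $v'\in V(G')$ and $e'\in E(G')$. The stable gonality $\mathrm{sgon}(G)$ of a graph $G$ is the minimum of $\deg\varphi$ over all finite harmonic morphisms $\varphi:G'\to T$ with $G'$ a (loopless) refinement of $G$ and $T$ a tree. *)

(* Defs.v *)
From mathcomp Require Import all_boot all_order all_algebra.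
From mathcomp Require Import boolp classical_sets reals.

Set Implicit Arguments.
Unset Strict Implicit.
Unset Printing Implicit Defensive.

Import Order.TTheory GRing.Theory Num.Theory.

(* Multigraphs with loops are allowed.  The pair [ends e] lists the two ends
   of [e] in an arbitrary order, equal for a loop; the order carries no
   meaning, and every notion below is insensitive to it (up to isomorphism). *)
Record mgraph := MGraph {
  vertex : finType;
  edge : finType;
  ends : edge -> vertex * vertex }.

Section Graphs.
Variable G : mgraph.
Implicit Types (x y v : vertex G) (e : edge G).

Definition joins e x y := (ends e == (x, y)) || (ends e == (y, x)).

Definition incident e v := (v == (ends e).1) || (v == (ends e).2).

Definition loopless := [forall e : edge G, (ends e).1 != (ends e).2].

Definition adjacent : rel (vertex G) := fun x y => [exists e : edge G, joins e x y].

Definition connected :=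
  (0 < #|vertex G|) && [forall x, forall y, connect adjacent x y].

(* |E| - |V| + 1 = 0, without truncated subtraction. *)
Definition tree := connected && (#|edge G| + 1 == #|vertex G|).

Definition degree v : nat :=
  \sum_(e : edge G) (((ends e).1 == v) + ((ends e).2 == v)).

Definition max_degree : nat := \max_(v : vertex G) degree v.

Definition adjacency_number x y : nat :=
  #|[set e : edge G | joins e x y]%SET| * (if x == y then 2 else 1).

End Graphs.

Section Laplacian.
Variables (R : realType) (G : mgraph).
Local Open Scope ring_scope.

Definition degree_mx : 'M[R]_#|vertex G| :=
  diag_mx (\row_i (degree (enum_val i))%:R).

Definition adjacency_mx : 'M[R]_#|vertex G| :=
  \matrix_(i, j) (adjacency_number (enum_val i) (enum_val j))%:R.

Definition laplacian : 'M[R]_#|vertex G| := degree_mx - adjacency_mx.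

(* The default value 0 is only taken when there is no non-zero eigenvalue,
   that is, for a connected graph, when there is a single vertex. *)
Definition lambda : R :=
  xget 0 [set l | [/\ eigenvalue laplacian l, l != 0 &
    forall mu, eigenvalue laplacian mu -> mu != 0 -> l <= mu]]%classic.

End Laplacian.

(* The new vertex is [None]; [Some e0] becomes one half of the subdivided
   edge and [None] is the other half. *)
Definition subdivide (G : mgraph) (e0 : edge G) : mgraph :=
  @MGraph (option (vertex G)) (option (edge G)) (fun o =>
    match o with
    | Some e => (Some (ends e).1, if e == e0 then None else Some (ends e).2)
    | None => (None, Some (ends e0).2)
    end).

Definition add_leaf (G : mgraph) (v : vertex G) : mgraph :=
  @MGraph (option (vertex G)) (option (edge G)) (fun o =>
    match o with
    | Some e => (Some (ends e).1, Some (ends e).2)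
    | None => (Some v, None)
    end).

Inductive refinement (G : mgraph) : mgraph -> Prop :=
| refinement_refl : refinement G G
| refinement_subdivide (H : mgraph) (e : edge H) :
    refinement G H -> refinement G (subdivide e)
| refinement_add_leaf (H : mgraph) (v : vertex H) :
    refinement G H -> refinement G (add_leaf v).

Record finite_morphism (G G' : mgraph) := FiniteMorphism {
  vmap : vertex G -> vertex G';
  emap : edge G -> edge G';
  index : edge G -> nat;
  emap_joins : forall e x y, joins e x y -> joins (emap e) (vmap x) (vmap y);
  index_gt0 : forall e, 0 < index e }.

(* [m] is the function called m_phi. *)
Definition harmonic (G G' : mgraph) (phi : finite_morphism G G')
    (m : vertex G -> nat) : Prop :=
  forall v,
    (forall e', incident e' (vmap phi v) ->
       m v = \sum_(e | incident e v && (emap phi e == e')) index phi e) /\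
    ((forall e', ~~ incident e' (vmap phi v)) -> 0 < m v).

(* Both sums are independent of v' and e' when phi is harmonic and
   G' is connected (G and G' being loopless): see [has_degree_exists]. *)
Definition has_degree (G G' : mgraph) (phi : finite_morphism G G')
    (m : vertex G -> nat) (d : nat) : Prop :=
  (forall v', \sum_(v | vmap phi v == v') m v = d) /\
  (forall e', \sum_(e | emap phi e == e') index phi e = d).

Definition refined_tree_degree (G : mgraph) (d : nat) : Prop :=
  exists (G' T : mgraph) (phi : finite_morphism G' T) (m : vertex G' -> nat),
    [/\ refinement G G', loopless G', loopless T, tree T &
        harmonic phi m /\ has_degree phi m d].

(* The set minimised over is never empty: see [refined_tree_degree_exists]. *)
Definition sgon (G : mgraph) : nat :=
  xget 0 [set d | refined_tree_degree G d /\
    forall d', refined_tree_degree G d' -> d <= d']%classic.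

Section DegreeExists.
Variables (G G' : mgraph) (phi : finite_morphism G G') (m : vertex G -> nat).
Hypotheses (loopG : loopless G) (loopG' : loopless G').
Hypotheses (connG' : connected G') (harm : harmonic phi m).

Let edge_sum e' v' : incident e' v' ->
  \sum_(v | vmap phi v == v') m v = \sum_(e | emap phi e == e') index phi e.
Proof.
move=> inc.
rewrite (eq_bigr (fun v =>
  \sum_(e | incident e v && (emap phi e == e')) index phi e)); last first.
  by move=> v /eqP vv'; have [mE _] := harm v; apply: mE; rewrite vv'.
rewrite (exchange_big_dep (fun e => emap phi e == e')) /=; last first.
  by move=> v e _ /andP[].
apply: eq_bigr => e ee'.
case Ee: (ends e) => [x y].
have xy : x != y by move/forallP: loopG => /(_ e); rewrite Ee.
have : joins (emap phi e) (vmap phi x) (vmap phi y).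
  by apply: emap_joins; rewrite /joins Ee eqxx.
have /forallP/(_ e') := loopG'; move: inc.
rewrite /joins (eqP ee') /incident; case: (ends e') => [a b] /= inc ab J.
rewrite (eq_bigl (fun v => ((v == x) || (v == y)) && (vmap phi v == v'))); last first.
  by move=> v; rewrite eqxx Ee andbT andbC.
case/orP: J => /eqP[Ea Eb]; case/orP: inc => /eqP ?; subst v' a b.
- rewrite (big_pred1 x) // => v /=; case: (v =P x) => [->|_] /=; first by rewrite eqxx.
  by case: (v =P y) => //= ->; rewrite eq_sym (negbTE ab).
- rewrite (big_pred1 y) // => v /=; case: (v =P y) => [->|_] /=; first by rewrite orbT eqxx.
  by case: (v =P x) => //= ->; rewrite (negbTE ab).
- rewrite (big_pred1 y) // => v /=; case: (v =P y) => [->|_] /=; first by rewrite orbT eqxx.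
  by case: (v =P x) => //= ->; rewrite eq_sym (negbTE ab).
- rewrite (big_pred1 x) // => v /=; case: (v =P x) => [->|_] /=; first by rewrite eqxx.
  by case: (v =P y) => //= ->; rewrite (negbTE ab).
Qed.

Lemma has_degree_exists : exists d, has_degree phi m d.
Proof.
have /andP[/card_gt0P[r _] /forallP/(_ r)/forallP conn] := connG'.
have eqd v' : \sum_(v | vmap phi v == v') m v = \sum_(v | vmap phi v == r) m v.
  have /connectP[p pp ->] := conn v'.
  elim: p r pp {conn} => //= y p IHp x /andP[/existsP[e J] pp].
  rewrite (IHp _ pp) (@edge_sum e y); last first.
    by case/orP: J => /eqP E; rewrite /incident E eqxx ?orbT.
  by rewrite (@edge_sum e x) //; case/orP: J => /eqP E; rewrite /incident E eqxx ?orbT.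
exists (\sum_(v | vmap phi v == r) m v); split=> // e'.
by rewrite -(eqd (ends e').1) (@edge_sum e') // /incident eqxx.
Qed.

End DegreeExists.

Section RefinedTreeDegreeExists.
Variable I : finType.

Let star : mgraph := @MGraph (option I) I (fun i => (None, Some i)).

Let tree_star : tree star.
Proof.
apply/andP; split; last by rewrite card_option addn1.
apply/andP; split; first by apply/card_gt0P; exists None.
have adj i : adjacent (G := star) None (Some i) /\ adjacent (G := star) (Some i) None.
  by split; apply/existsP; exists i; rewrite /joins /= eqxx ?orbT.
have from u : connect (adjacent (G := star)) None u.
  by case: u => [i|]; [apply/connect1; case: (adj i) | exact: connect0].
apply/forallP=> u; apply/forallP=> v; apply: connect_trans (from v).
by case: u => [i|]; [apply/connect1; case: (adj i) | exact: connect0].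
Qed.

Let loopless_star : loopless star.
Proof. by apply/forallP. Qed.

Let sum_option (T : finType) (F : option T -> nat) :
  \sum_o F o = F None + \sum_x F (Some x).
Proof.
rewrite (bigD1 None) //=; congr (_ + _).
rewrite (reindex_omap Some id) /=; last by case.
by apply: eq_bigl => x; rewrite eqxx.
Qed.

Let weight (H : mgraph) (g : edge H -> I) (r : edge H -> nat) v i :=
  \sum_(e : edge H) (incident e v && (g e == i)) * r e.

(* A partial harmonic morphism to the star, where every vertex over the centre
   has multiplicity 2; the edges with [r e = 0] are not mapped yet. *)
Let state (H : mgraph) (f : vertex H -> option I) (g : edge H -> I)
    (r : edge H -> nat) := [/\
  forall e, 0 < r e -> (f (ends e).1, f (ends e).2) = (None, Some (g e)) \/
                       (f (ends e).1, f (ends e).2) = (Some (g e), None),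
  forall e, r e = 0 -> f (ends e).1 = None /\ f (ends e).2 = None,
  forall e e', r e = 0 -> g e = g e' -> e = e' &
  forall v i, f v = None -> weight g r v i = 0 \/ weight g r v i = 2].

Let todo (H : mgraph) (r : edge H -> nat) := #|[set e | r e == 0]%SET|.

Let defect (H : mgraph) (f : vertex H -> option I) g r :=
  #|[set p | (f p.1 == None) && (@weight H g r p.1 p.2 == 0)]%SET|.

Let subdivide_state (H : mgraph) f g r (e0 : edge H) : state f g r -> r e0 = 0 ->
  exists f' g' r', @state (subdivide e0) f' g' r' /\ @todo (subdivide e0) r' < todo r.
Proof.
move=> [Hpos H0 Hinj Hw] r0.
pose c := if (ends e0).1 == (ends e0).2 then 1 else 2.
pose f' (o : option (vertex H)) := if o is Some v then f v else Some (g e0).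
pose g' (o : option (edge H)) := if o is Some e then g e else g e0.
pose r' (o : option (edge H)) :=
  if o is Some e then if e == e0 then c else r e else c.
have c0 : 0 < c by rewrite /c; case: ifP.
have [f1 f2] := H0 _ r0.
exists f', g', r'; split; first split.
- case=> [e|] /=; last by rewrite f2; right.
  case: eqP => [->|_] /=; first by rewrite f1; left.
  exact: Hpos.
- case=> [e|] /=; last by move=> E; rewrite E in c0.
  case: eqP => [_ E|_ /H0//]; by rewrite E in c0.
- move=> [e|] e' /=; last by move=> E; rewrite E in c0.
  case: eqP => [_ E|ne E]; first by rewrite E in c0.
  by case: e' => [e'|] /= /(Hinj _ _ E) => [->|/ne].
- case=> [v|] //= i fv.
  have SE (x y : vertex H) : (Some x == Some y) = (x == y) by [].
  have -> : @weight (subdivide e0) g' r' (Some v) i =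
    ((v == (ends e0).2) && (g e0 == i)) * c +
    (((v == (ends e0).1) && (g e0 == i)) * c +
     \sum_(e | e != e0) (incident e v && (g e == i)) * r e).
    rewrite /weight sum_option (bigD1 e0) //=.
    rewrite /incident /= (eqxx e0) !SE orbF; congr (_ + (_ + _)).
    by apply: eq_bigr => e /negbTE ->.
  have := Hw v i fv; rewrite /weight (bigD1 e0) //= r0 muln0 add0n.
  case: (g e0 =P i) => [<-|_]; last by rewrite !andbF !mul0n !add0n.
  rewrite big1 ?addn0 => [_|e /eqP ne]; last first.
    by case: eqP => [/esym/(Hinj _ _ r0)/esym/ne|]; rewrite ?andbF.
  rewrite !andbT /c; case: (v =P (ends e0).1) => [->|ne].
    by case: eqP; auto.
  by case: (v =P (ends e0).2) => [<-|_]; [case: eqP => [/esym/ne|]|]; auto.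
- apply: (@leq_trans #|[set Some e | e in [set e | r e == 0] :\ e0]%SET|.+1).
    rewrite ltnS; apply/subset_leq_card/fintype.subsetP => -[e|]; rewrite !inE /=.
      case: (e =P e0) => [_ /eqP E|ne re]; first by rewrite E in c0.
      by apply/imsetP; exists e; rewrite // !inE re andbT; apply/eqP.
    by move=> /eqP E; rewrite E in c0.
  rewrite card_imset; last exact: Some_inj.
  by rewrite /todo [X in _ <= X](cardsD1 e0) inE r0 eqxx.
Qed.

Let add_leaf_state (H : mgraph) f g r : @state H f g r -> todo r = 0 ->
    0 < defect f g r ->
  exists (v0 : vertex H) f' g' r', [/\ @state (add_leaf v0) f' g' r',
    @todo (add_leaf v0) r' = 0 & @defect (add_leaf v0) f' g' r' < defect f g r].
Proof.
move=> [Hpos H0 Hinj Hw] /eqP; rewrite cards_eq0 => /eqP todo0.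
have r0 e : 0 < r e by rewrite lt0n; move/setP/(_ e): todo0; rewrite !inE => ->.
case/card_gt0P=> -[v0 i0]; rewrite inE /= => /andP[/eqP fv0 /eqP w0].
pose f' (o : option (vertex H)) := if o is Some v then f v else Some i0.
pose g' (o : option (edge H)) := if o is Some e then g e else i0.
pose r' (o : option (edge H)) := if o is Some e then r e else 2.
have r'0 o : r' o <> 0 by case: o => [e|] //=; have := r0 e; case: (r e).
have wE v i : @weight (add_leaf v0) g' r' (Some v) i =
    ((v == v0) && (i0 == i)) * 2 + weight g r v i.
  have SE (x y : vertex H) : (Some x == Some y) = (x == y) by [].
  by rewrite /weight sum_option /incident /= SE orbF.
exists v0, f', g', r'; split; first split.
- by case=> [e|] _ /=; [exact: Hpos | rewrite fv0; left].
- by move=> o /r'0.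
- by move=> o o' /r'0.
- case=> [v|] //= i fv; rewrite wE.
  case: (v =P v0) => [->|_] /=; last exact: Hw.
  by case: (i0 =P i) => [<-|_] /=; [rewrite w0; right | exact: Hw].
- by apply/eqP; rewrite cards_eq0; apply/eqP/setP => o; rewrite !inE; apply/eqP/r'0.
- set D := [set p | (f p.1 == None) && (weight g r p.1 p.2 == 0)]%SET.
  have vi : (v0, i0) \in D by rewrite inE /= fv0 w0 !eqxx.
  rewrite /defect -/D (cardsD1 (v0, i0)) vi add1n ltnS.
  have inj : injective (fun p : vertex H * I => (Some p.1, p.2)).
    by move=> [? ?] [? ?] [-> ->].
  rewrite -(card_imset (mem (D :\ (v0, i0))%SET) inj).
  apply/subset_leq_card/fintype.subsetP => -[[v|] i]; rewrite inE //= wE.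
  case/andP=> fv; rewrite addn_eq0 muln_eq0 /= orbF eqb0 => /andP[ne w].
  apply/imsetP; exists (v, i); rewrite // !inE /= fv w !andbT.
  by apply: contraNneq ne => -[-> ->]; rewrite !eqxx.
Qed.

Let final_state (H : mgraph) f g r : @state H f g r -> todo r = 0 ->
    defect f g r = 0 ->
  exists (phi : finite_morphism H star) (m : vertex H -> nat),
    [/\ loopless H, harmonic phi m & exists d, has_degree phi m d].
Proof.
move=> [Hpos H0 Hinj Hw] /eqP; rewrite cards_eq0 => /eqP todo0.
have r0 e : 0 < r e by rewrite lt0n; move/setP/(_ e): todo0; rewrite !inE => ->.
move=> /eqP; rewrite cards_eq0 => /eqP defect0.
have w2 v i : f v = None -> weight g r v i = 2.
  move=> fv; have [w|//] := Hw v i fv.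
  by move/setP/(_ (v, i)): defect0; rewrite !inE /= fv w !eqxx.
have jn e x y : joins e x y -> joins (G := star) (g e) (f x) (f y).
  by rewrite /joins /= => /orP[] /eqP E; have [] := Hpos e (r0 e);
    rewrite E /= => -[-> ->]; rewrite !eqxx ?orbT.
have lH : loopless H.
  apply/forallP=> e; apply/eqP=> E.
  by have [] := Hpos e (r0 e); rewrite E => -[->].
pose phi : finite_morphism H star := @FiniteMorphism H star f g r jn r0.
pose m v := if f v is None then 2 else \sum_(e : edge H | incident e v) r e.
have hphi : harmonic phi m.
  move=> v; split=> [i|]; last first.
    rewrite /m; case fv: (f v) => [i|] // /(_ i) /negP[].
    by rewrite /incident /= fv eqxx.
  rewrite [incident (G := star) _ _]/incident /= /m; case fv: (f v) => [j|] /=.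
    move=> /eqP[<-]; apply: eq_bigl => e.
    case inc: (incident e v) => //=; apply/esym/eqP.
    by case/orP: inc => /eqP E; have [] := Hpos e (r0 e); rewrite -E fv => -[].
  move=> _; rewrite -(w2 v i fv) /weight [RHS]big_mkcond; apply: eq_bigr => e _.
  by rewrite /incident; case: ifP; rewrite ?mul1n.
exists phi, m; split=> //; apply: has_degree_exists => //.
by case/andP: tree_star.
Qed.

Let refined_degree_star (G H : mgraph) f g r : refinement G H -> @state H f g r ->
  exists d, refined_tree_degree G d.
Proof.
have [n] := ubnP (todo r); elim: n H f g r => // n IHn H f g r.
rewrite ltnS => lern GH st; case: (posnP (todo r)) => [t0|]; last first.
  case/card_gt0P=> e0; rewrite inE => /eqP r0.
  have [f' [g' [r' [st' lt']]]] := subdivide_state st r0.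
  by apply: IHn st'; [exact: leq_trans lt' lern | exact: refinement_subdivide].
have [k] := ubnP (defect f g r).
elim: k H f g r GH st t0 {lern} => // k IHk H f g r GH st t0; rewrite ltnS => lek.
case: (posnP (defect f g r)) => [d0|dpos].
  have [phi [m [lH hphi [d dphi]]]] := final_state st t0 d0.
  exists d, H, star, phi, m; split=> //.
have [v0 [f' [g' [r' [st' t' lt']]]]] := add_leaf_state st t0 dpos.
by apply: IHk st' t' _; [exact: refinement_add_leaf | exact: leq_trans lt' lek].
Qed.

Lemma refined_tree_degree_exists_star (G : mgraph) (g : edge G -> I) :
  injective g -> exists d, refined_tree_degree G d.
Proof.
move=> ginj; apply: (@refined_degree_star G G (fun=> None) g (fun=> 0)).
  exact: refinement_refl.
split=> // [e e' _ /ginj//|v i _]; left.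
by apply: big1 => e _; rewrite muln0.
Qed.

End RefinedTreeDegreeExists.

Lemma refined_tree_degree_exists (G : mgraph) : exists d, refined_tree_degree G d.
Proof. by apply: (@refined_tree_degree_exists_star (edge G) G id). Qed.

(* Main.v *)
Require Import Defs.
From mathcomp Require Import all_boot all_order all_algebra.
From mathcomp Require Import boolp classical_sets reals.
From mathcomp Require Import complex.
From mathcomp Require Import zify ring lra.

(** A finite harmonic morphism of degree [d] from a refinement of [G] to a tree
    cuts [G] cheaply.  Write [n] for the number of vertices of [G], [D] for its
    maximal degree and [l] for its first eigenvalue; the claim is equivalent to
    [l * (n - d) <= 4 * d * (D + 1)] ([eigenvalue_le_degree]).

    Weight each vertex of the tree by the number of vertices of [G] over it, and
    let [t] be a centroid of the tree ([tree_centroid]).  The fibre over [t] has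
    at most [d] points.  Some of them are vertices of [G], the others lie on
    subdivided edges of [G] or on added branches; a path in the refinement between
    two different branches of the tree at [t] must meet this fibre.  Hence, for
    any grouping of the branches into two sides, the [k] edges of [G] going
    directly from one side to the other and the [s] vertices of [G] over [t]
    satisfy [k + s <= d] ([refinement_cut], [pullback_cut]).  If [3 * d < n], the
    branches can be grouped so that neither side has more than three times as many
    vertices as the other ([balanced_subset], [tree_separation]).

    The Laplacian quadratic form is the sum over the edges of the squared
    differences ([laplacian_energy]), and by the spectral theorem it is at least
    [l] times the squared norm on functions of sum 0 ([lambda_rayleigh]).  Testing
    this on the function that is constant on each side, 0 over [t], and of sum 0
    bounds [l] in terms of [k] and [s] ([cut_rayleigh]), which gives the claim.  If
    [3 * d >= n], the claim follows from [l <= 2 * D]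
    ([laplacian_eigenvalue_bounds]). *)

Set Implicit Arguments.
Unset Strict Implicit.
Unset Printing Implicit Defensive.

Import Order.TTheory GRing.Theory Num.Theory.

(** * Cuts of a graph and of its refinements *)

(** A colouring of the vertices by [option bool] is a cut with a separator: the
    two sides are [Some true] and [Some false], and [None] is the separator. *)
Definition crosses (a b : option bool) := [&& isSome a, isSome b & a != b].

Definition cut_size (H : mgraph) (c : vertex H -> option bool) :=
  \sum_(e : edge H) crosses (c (ends e).1) (c (ends e).2).

Definition separator_size (H : mgraph) (c : vertex H -> option bool) :=
  \sum_(v : vertex H) (c v == None).

Lemma sum_option (T : finType) (F : option T -> nat) :
  \sum_o F o = F None + \sum_x F (Some x).
Proof.
rewrite (bigD1 None) //=; congr (_ + _).
rewrite (reindex_omap Some id) /=; last by case.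
by apply: eq_bigl => x; rewrite eqxx.
Qed.

(** If the subdivided edge crosses the cut, then its new midpoint either joins
    the separator or lies on one of the two sides, and then one of the two
    halves still crosses. *)
Lemma subdivide_cut (H : mgraph) (e0 : edge H) (c : vertex (subdivide e0) -> option bool) :
  cut_size (c \o Some : vertex H -> _) + separator_size (c \o Some : vertex H -> _) <=
  cut_size c + separator_size c.
Proof.
rewrite /cut_size /separator_size !sum_option /= (bigD1 e0) //=.
rewrite [X in _ <= _ + X + _](bigD1 e0) //= eqxx.
set S1 := \sum_(i | i != e0) _; set S2 := \sum_(i | i != e0) _.
have -> : S2 = S1 by apply: eq_bigr => e /negbTE ->.
have arith (a b d f s u : nat) : a <= b + d + f -> a + s + u <= b + (d + s) + (f + u).
  by lia.
have : crosses (c (Some (ends e0).1)) (c (Some (ends e0).2)) <=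
  crosses (c None) (c (Some (ends e0).2)) + crosses (c (Some (ends e0).1)) (c None)
  + (c None == None).
  by case: (c None) (c (Some (ends e0).1)) (c (Some (ends e0).2)) => [[]|] [[]|] [[]|].
exact: arith.
Qed.

Lemma add_leaf_cut (H : mgraph) (v : vertex H) (c : vertex (add_leaf v) -> option bool) :
  cut_size (c \o Some : vertex H -> _) + separator_size (c \o Some : vertex H -> _) <=
  cut_size c + separator_size c.
Proof. by rewrite /cut_size /separator_size !sum_option /=; apply: leq_add; apply: leq_addl. Qed.

(** A vertex of the separator of the refinement that subdivides an edge accounts
    for that edge, so one never cuts more in [G] than in the refinement.  The map
    [iota] is the inclusion of the original vertices. *)
Lemma refinement_cut (G H : mgraph) : refinement G H ->
  exists iota : vertex G -> vertex H, forall c : vertex H -> option bool,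
    cut_size (c \o iota) + separator_size (c \o iota) <= cut_size c + separator_size c.
Proof.
elim=> [|H' e _ [iota IH]|H' v _ [iota IH]]; first by exists id.
- by exists (Some \o iota) => c; apply: leq_trans (IH (c \o Some)) (subdivide_cut c).
- by exists (Some \o iota) => c; apply: leq_trans (IH (c \o Some)) (add_leaf_cut c).
Qed.

(** Every vertex having an edge is what makes all the multiplicities of a
    harmonic map positive: at an isolated vertex over a non-isolated one the
    empty sum would force the multiplicity 0. *)
Definition no_isolated (H : mgraph) := forall v : vertex H, exists e, incident e v.

Lemma refinement_no_isolated G H : refinement G H -> no_isolated G -> no_isolated H.
Proof.
move=> GH isoG; elim: GH => [|H' e0 _ IH|H' v0 _ IH] //.
- case=> [v|]; last by exists None; rewrite /incident.
  have [e inc] := IH v; have [ee0|ne] := eqVneq e e0; last first.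
    by exists (Some e); move: inc; rewrite /incident /= (negbTE ne).
  by case/orP: inc => inc; [exists (Some e)|exists None];
    rewrite /incident /= (eqP inc) ?ee0 eqxx ?orbT.
- case=> [v|]; last by exists None; rewrite /incident orbT.
  by have [e inc] := IH v; exists (Some e).
Qed.

Lemma connected_no_isolated (G : mgraph) :
  connected G -> 1 < #|vertex G| -> no_isolated G.
Proof.
case/andP=> _ /forallP conn card v.
have [w wv] : exists w, w != v.
  have : 0 < #|predC1 v| by rewrite cardC1; lia.
  by case/card_gt0P=> w; exists w.
have /forallP/(_ w)/connectP[[|x p] /=] := conn v.
  by move=> _ E; rewrite E eqxx in wv.
case/andP=> /existsP[e J] _ _; exists e.
by case/orP: J => /eqP E; rewrite /incident E eqxx ?orbT.
Qed.

(** * Centroids of trees *)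

(** Take [X] of minimal cardinality among the sets carrying a quarter of the
    weight.  If it carries more than three quarters, then losing any of its
    elements costs more than half of the weight, so that element alone is
    balanced. *)
Lemma balanced_subset (I : finType) (w : I -> nat) :
  let N := \sum_i w i in (forall i, 4 * w i <= 3 * N) ->
  exists X : {set I}, N <= 4 * \sum_(i in X) w i <= 3 * N.
Proof.
move=> N small.
have big_setT : N <= 4 * \sum_(i in [set: I]) w i.
  by rewrite (eq_bigl xpredT) => [|i]; [rewrite -/N; lia | rewrite inE].
have [X NX minX] := arg_minnP (P := fun X : {set I} => N <= 4 * \sum_(i in X) w i)
  (fun X => #|X|) big_setT.
have [XN|XN] := leqP (4 * \sum_(i in X) w i) (3 * N); first by exists X; rewrite NX.
have [i iX] : exists i, i \in X.
  have [E|[i iX]] := set_0Vmem X; last by exists i.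
  by rewrite E big_set0 in XN; lia.
have : ~~ (N <= 4 * \sum_(j in X :\ i) w j).
  by apply/negP => /minX; rewrite [in X in X <= _](cardsD1 i X) iX; lia.
have XE : \sum_(j in X) w j = w i + \sum_(j in X :\ i) w j := big_setD1 i iX.
have := small i; rewrite -ltnNge => small_i small'.
exists [set i]; rewrite big_set1 small andbT; lia.
Qed.

(** The parent of a vertex is a neighbour closer to the root for the distance [h].
    Each vertex other than the root is the upper end of the edge to its parent,
    so these edges already number |V| - 1, and there is no room for others. *)
Lemma tree_parent (T : mgraph) : tree T ->
  exists (r : vertex T) (p : vertex T -> vertex T) (h : vertex T -> nat),
    [/\ p r = r, forall v, v != r -> h (p v) < h v &
        forall e : edge T, exists v, joins e v (p v)].
Proof.
case/andP=> /andP[/card_gt0P[r _] /forallP/(_ r)/forallP conn] /eqP card.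
pose reach v n := [exists q : n.-tuple (vertex T), path (@adjacent T) r q && (last r q == v)].
have ex_reach v : exists n, reach v n.
  have /connectP[q rq vE] := conn v; exists (size q).
  by apply/existsP; exists (in_tuple q); rewrite rq vE eqxx.
pose h v := ex_minn (ex_reach v).
have [p pP] : exists p : vertex T -> vertex T, forall v,
    if v == r then p v == r else adjacent (p v) v && (h (p v) < h v).
  apply: (@fin_all_exists _ _ (fun v u => is_true (if v == r then u == r
    else adjacent u v && (h u < h v)))) => v; have [_|vr] := eqVneq v r; first by exists r.
  rewrite {2}/h; case: ex_minnP => n /existsP[[q /= /eqP sq] /andP[rq /eqP qv]] _.
  case/lastP: q sq rq qv => [|q x]; first by move=> _ _ /= rv; rewrite -rv eqxx in vr.
  rewrite size_rcons rcons_path last_rcons => <- /andP[rq qx] <-.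
  exists (last r q); rewrite qx /h; case: ex_minnP => m _ minm; apply: minm.
  by apply/existsP; exists (in_tuple q); rewrite rq eqxx.
have hp v : v != r -> h (p v) < h v.
  by move=> vr; have := pP v; rewrite (negbTE vr) => /andP[].
exists r, p, h; split=> //; first by have := pP r; rewrite eqxx => /eqP.
pose S := [set e : edge T | [exists v, joins e v (p v)]].
pose top e := if h (ends e).1 < h (ends e).2 then (ends e).2 else (ends e).1.
have : #|vertex T|.-1 <= #|S|.
  rewrite -(cardC1 r); apply: leq_trans (leq_imset_card top S).
  apply/subset_leq_card/fintype.subsetP => v; rewrite inE => vr.
  have := pP v; rewrite (negbTE vr) => /andP[/existsP[e J] lt].
  have J' : joins e v (p v) by rewrite /joins orbC.
  apply/imsetP; exists e; first by rewrite inE; apply/existsP; exists v.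
  by rewrite /top; case/orP: J => /eqP -> /=; [rewrite lt | rewrite ltnNge (ltnW lt)].
move=> cardS e; have /eqP ST : S == [set: edge T]%SET.
  by rewrite eqEcard finset.subsetT cardsT; lia.
have : e \in S by rewrite ST finset.in_setT.
by rewrite inE => /existsP.
Qed.

(** [t] is the deepest vertex whose subtree carries at least half of the weight.
    The branches at [t] are the subtrees of its children, light because the
    children are deeper, and the complement of the subtree of [t], light because
    that subtree is heavy.  [kappa] names the branch: [Some c] for the subtree of
    the child [c], [None] for the complement. *)
Lemma tree_centroid (T : mgraph) (w : vertex T -> nat) : tree T ->
  exists (t : vertex T) (kappa : vertex T -> option (vertex T)),
    (forall e x y, joins (e : edge T) x y -> x != t -> y != t -> kappa x = kappa y) /\
    (forall i, 2 * \sum_(u | (u != t) && (kappa u == i)) w u <= \sum_u w u).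
Proof.
case/tree_parent=> r [p [h [pr hp pE]]].
(* [u] lies in the subtree of [v] when iterating the parent map on [u] reaches [v]. *)
pose desc v u := fconnect p u v.
have desc_step v u : desc v u = (u == v) || desc v (p u).
  apply/idP/orP => [|[/eqP ->|]]; last first.
  - by move=> d; apply: connect_trans d; apply: fconnect1.
  - exact: connect0.
  case/connectP=> [[|x q] /=]; first by move=> _ ->; left.
  by case/andP=> /eqP px pq vE; right; apply/connectP; exists q; rewrite px.
pose mass v := \sum_(u | desc v u) w u.
have desc_r u : desc r u.
  have [n] := ubnP (h u); elim: n u => // n IHn u lt.
  rewrite desc_step; have [//|/hp lt'] := eqVneq u r.
  by apply: IHn; lia.
have rP : \sum_u w u <= 2 * mass r.
  by rewrite /mass (eq_bigl _ _ desc_r); lia.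
have [t tP tmax] := arg_maxnP (P := fun v => \sum_u w u <= 2 * mass v) h rP.
pose child c := (p c == t) && (c != t).
pose kappa u := [pick c | child c && desc c u].
have kappa_p v : v != t -> p v != t -> kappa v = kappa (p v).
  move=> vt pvt; apply: eq_pick => c /=; rewrite [desc c v]desc_step.
  by case: eqP => //= <-; rewrite /child (negbTE pvt).
exists t, kappa; split=> [e x y|i].
  have [v J] := pE e => J' xt yt.
  by move: J J'; rewrite /joins => /orP[] /eqP -> /orP[] /eqP [? ?]; subst x y;
    rewrite (kappa_p v).
case: i => [c|].
  have [ch|nch] := boolP (child c); last first.
    rewrite big_pred0 // => u; apply/negP => /andP[_]; rewrite /kappa.
    by case: pickP => // c' /andP[ch _] /eqP[E]; rewrite -E ch in nch.
  have lt : 2 * mass c < \sum_u w u.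
    rewrite ltnNge; apply/negP => /tmax; case/andP: ch => /eqP pc ct.
    have cr : c != r by apply: contraNneq ct => cr; rewrite -pc cr pr.
    by have := hp _ cr; rewrite pc; lia.
  apply: leq_trans (ltnW lt); rewrite leq_mul2l /=.
  rewrite [leqRHS]big_mkcond [leqLHS]big_mkcond; apply: leq_sum => u _.
  case: ifP => // /andP[_]; rewrite /kappa; case: pickP => // c' /andP[_ d] /eqP[<-].
  by rewrite d.
suff : \sum_(u | (u != t) && (kappa u == None)) w u + mass t <= \sum_u w u by lia.
rewrite /mass [X in X + _]big_mkcond [X in _ + X]big_mkcond -big_split /=; apply: leq_sum => u _.
case: ifP => [/andP[ut]|_]; last by case: ifP.
rewrite /kappa; case: pickP => // none _; case: ifP => //; rewrite ?addn0 // => d.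
suff [c /andP[ch dc]] : exists c, child c && desc c u by have := none c; rewrite /= ch dc.
case/connectP: d => q; elim: q u ut {none} => [|x q IHq] u ut /=.
  by move=> _ E; rewrite E eqxx in ut.
case/andP=> /eqP <- pq E; have [put|put] := eqVneq (p u) t.
  by exists u; rewrite /child put eqxx ut /desc connect0.
have [c /andP[ch dc]] := IHq _ put pq E.
by exists c; rewrite ch desc_step dc orbT.
Qed.

(** The branches at a centroid carry at most half of the whole weight, hence at
    most three quarters of the weight away from [t], since [t] itself carries
    less than a third; so they can be grouped into two comparable halves. *)
Lemma tree_separation (T : mgraph) (w : vertex T -> nat) : tree T ->
    (forall t, 3 * w t < \sum_u w u) ->
  exists (t : vertex T) (c : vertex T -> option bool),
    let mass b := \sum_(u | c u == Some b) w u in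
    [/\ forall u, (c u == None) = (u == t),
        forall e x y, joins (e : edge T) x y -> ~~ crosses (c x) (c y),
        mass true <= 3 * mass false & mass false <= 3 * mass true].
Proof.
move=> treeT small; have [t [kappa [mono half]]] := tree_centroid w treeT.
pose wt i := \sum_(u | (u != t) && (kappa u == i)) w u.
have part (P : pred (option (vertex T))) :
    \sum_(i | P i) wt i = \sum_(u | (u != t) && P (kappa u)) w u.
  rewrite (exchange_big_dep (fun u => (u != t) && P (kappa u))) /=; last first.
    by move=> i u Pi /andP[-> /eqP ->].
  apply: eq_bigr => u /andP[ut Pu]; rewrite (big_pred1 (kappa u)) // => i /=.
  by rewrite ut /= eq_sym; case: eqP => [->|_]; rewrite ?Pu ?andbF.
have tot : w t + \sum_i wt i = \sum_u w u.
  by rewrite (part xpredT) [RHS](bigD1 t) //=; congr (_ + _); apply: eq_bigl => u; rewrite andbT.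
have := small t => smallt.
have [|X /andP[XN NX]] := @balanced_subset _ wt.
  by move=> i; have := half i; rewrite -/(wt i); lia.
pose c u := if u == t then None else Some (kappa u \in X).
have mt : \sum_(u | c u == Some true) w u = \sum_(i in X) wt i.
  rewrite part; apply: eq_bigl => u; rewrite /c; case: (u =P t) => //=.
have mf : \sum_(u | c u == Some false) w u = \sum_(i in ~: X) wt i.
  rewrite part; apply: eq_bigl => u; rewrite /c inE; case: (u =P t) => //=.
exists t, c => /=; rewrite mt mf.
have splitX : \sum_i wt i = \sum_(i in X) wt i + \sum_(i in ~: X) wt i.
  by rewrite (bigID (mem X)) /=; congr (_ + _); apply: eq_bigl => i; rewrite inE.
split; [by move=> u; rewrite /c; case: (u =P t) | | lia | lia].
move=> e x y J; rewrite /crosses /c; case: (x =P t) => // /eqP xt; case: (y =P t) => // /eqP yt /=.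
by rewrite (mono _ _ _ J xt yt) eqxx.
Qed.

(** * Pulling back cuts along harmonic morphisms *)

Lemma harmonic_gt0 (H T : mgraph) (phi : finite_morphism H T) m :
  no_isolated H -> harmonic phi m -> forall v, 0 < m v.
Proof.
move=> iso harm v; have [e inc] := iso v; have [mE _] := harm v.
have [y J] : exists y, joins e v y.
  by case/orP: inc => /eqP ->; [exists (ends e).2 | exists (ends e).1];
    rewrite /joins -surjective_pairing eqxx ?orbT.
have J' := emap_joins phi J.
rewrite (mE (emap phi e)); last first.
  by case/orP: J' => /eqP E; rewrite /incident E eqxx ?orbT.
by rewrite (bigD1 e) /= ?inc ?eqxx // ltn_addr // index_gt0.
Qed.

(** A cut of the tree with a single vertex [t] as separator and no crossing edge
    pulls back to a cut of the refinement without crossing edges, separated by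
    the fibre over [t]; that fibre has at most [d] points as its multiplicities
    are positive and sum to [d]. *)
Lemma pullback_cut (G H T : mgraph) (phi : finite_morphism H T) m d :
    refinement G H -> no_isolated G -> harmonic phi m -> has_degree phi m d ->
  exists iota : vertex G -> vertex H, forall (t : vertex T) (c : vertex T -> option bool),
    (forall u, (c u == None) = (u == t)) ->
    (forall e x y, joins (e : edge T) x y -> ~~ crosses (c x) (c y)) ->
  cut_size (c \o vmap phi \o iota) + separator_size (c \o vmap phi \o iota) <= d.
Proof.
move=> GH isoG harm [degv _]; have [iota cutle] := refinement_cut GH.
exists iota => t c cN mono; apply: leq_trans (cutle (c \o vmap phi)) _.
have -> : cut_size (c \o vmap phi) = 0.
  apply: big1 => e _; apply/eqP; rewrite eqb0; apply: (mono (emap phi e)).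
  by apply: emap_joins; rewrite /joins -surjective_pairing eqxx.
rewrite add0n -(degv t) [leqRHS]big_mkcond /=; apply: leq_sum => v _ /=.
rewrite cN; case: eqP => // _.
exact: (harmonic_gt0 (refinement_no_isolated GH isoG) harm).
Qed.

(** The tree is weighted by the number of original vertices over each of its
    vertices, so that balanced sides in the tree pull back to balanced sides. *)
Lemma refined_tree_degree_cut (G : mgraph) d :
    no_isolated G -> refined_tree_degree G d -> 3 * d < #|vertex G| ->
  exists c : vertex G -> option bool,
    let mass b := \sum_x (c x == Some b) in
    [/\ cut_size c + separator_size c <= d,
        mass true <= 3 * mass false & mass false <= 3 * mass true].
Proof.
move=> iso [H [T [phi [m [GH _ _ treeT [harm degd]]]]]] small.
have [iota pull] := pullback_cut GH iso harm degd.
pose w u := \sum_x (vmap phi (iota x) == u).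
have count (P : pred (vertex T)) :
    \sum_(u | P u) w u = \sum_x P (vmap phi (iota x)).
  rewrite exchange_big /=; apply: eq_bigr => x _.
  rewrite big_mkcond (bigD1 (vmap phi (iota x))) //= eqxx big1 ?addn0 => [|u].
    by case: (P _).
  by rewrite eq_sym => /negbTE ->; case: (P _).
have tot : \sum_u w u = #|vertex G| by rewrite (count xpredT) sum1_card.
(* The colouring with one side only shows that few vertices lie over [t]. *)
have w_small t : 3 * w t < \sum_u w u.
  rewrite tot; apply: leq_ltn_trans small; rewrite leq_mul2l /=.
  apply: leq_trans (pull t (fun u => if u == t then None else Some true) _ _).
  - rewrite /w /separator_size -[leqLHS]add0n; apply: leq_add => //.
    by apply: leq_sum => x _ /=; case: (vmap phi (iota x) =P t).
  - by move=> u; case: (u =P t).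
  - by move=> e x y _; case: (x =P t); case: (y =P t).
have [t [c [cN mono tf ft]]] := tree_separation treeT w_small.
exists (c \o vmap phi \o iota); rewrite !count in tf ft.
by split=> //; apply: (pull t).
Qed.

Local Open Scope ring_scope.

(** * The Rayleigh quotient of the Laplacian *)

Section SymmetricRayleigh.
Import Num.Def.
Local Open Scope sesquilinear_scope.

(** Over the complex numbers [A] has a unitary eigenbasis, in which both sides are
    weighted sums of the squared moduli of the coordinates of [f].  If the
    coordinate on an eigenvector is non-zero, so is the product of [f] with its
    real or its imaginary part, which is again an eigenvector, now over [R]; by
    the assumption on the kernel its eigenvalue is non-zero, so at least [l]. *)
Lemma symmetric_rayleigh (R : rcfType) n (A : 'M[R]_n) (l : R) (f : 'rV_n) :
    A^T = A ->
    (forall mu, eigenvalue A mu -> mu != 0 -> l <= mu) ->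
    (forall v : 'rV_n, v *m A = 0 -> (v *m f^T) 0 0 = 0) ->
  l * (f *m f^T) 0 0 <= (f *m A *m f^T) 0 0.
Proof.
move=> symA minl kerf.
pose toC := real_complex R : R -> R[i].
have conjtoC (p q : nat) (M : 'M[R]_(p, q)) : map_mx conjC (map_mx toC M) = map_mx toC M.
  by apply/matrixP=> i j; rewrite !mxE; exact: conjc_real.
pose Ac := map_mx toC A.
have normAc : Ac \is normalmx.
  by apply/normalmxP; rewrite map_trmx symA conjtoC.
have AcE := orthomx_spectralP normAc.
set P := spectralmx Ac in AcE; set sp := spectral_diag Ac in AcE.
have uP : P \is unitarymx := spectral_unitarymx Ac.
have PA : P *m Ac = diag_mx sp *m P.
  by rewrite {1}AcE !mulmxA mulmxV ?mul1mx // spectral_unit.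
have spreal i : exists k, sp 0 i = toC k.
  have : sp \is a realmx.
    apply: hermitian_spectral_diag_real; apply: realsym_hermsym.
      by apply/is_hermitianmxP; rewrite expr0 scale1r map_mx_id // map_trmx symA.
    by apply/mxOverP => a b; rewrite mxE; apply/complex_realP; exists (A a b).
  by move/mxOverP/(_ 0 i)/complex_realP.
(* The coordinates of [f] in the eigenbasis formed by the rows of [P]. *)
have [g gE] : exists g, g = map_mx toC f *m P^t* by exists (map_mx toC f *m P^t*).
have fcE : map_mx toC f = g *m P.
  by rewrite gE -mulmxA -invmx_unitary // mulVmx ?mulmx1 // spectral_unit.
have gtE : g^t* = P *m map_mx toC f^T.
  by rewrite gE trmx_mul map_mxM !map_trmx trmxK map_mxCK conjtoC.
have quadE : toC ((f *m A *m f^T) 0 0) = \sum_i sp 0 i * `|g 0 i| ^+ 2.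
  transitivity ((map_mx toC (f *m A *m f^T)) 0 0); first by rewrite [RHS]mxE.
  rewrite 2!map_mxM -/Ac fcE -(mulmxA g) PA -!mulmxA -gtE mxE.
  by apply: eq_bigr => i _; rewrite mul_diag_mx 3!mxE normCK mulrCA.
have normE : toC ((f *m f^T) 0 0) = \sum_i `|g 0 i| ^+ 2.
  transitivity ((map_mx toC (f *m f^T)) 0 0); first by rewrite [RHS]mxE.
  rewrite map_mxM fcE -mulmxA -gtE mxE.
  by apply: eq_bigr => i _; rewrite !mxE normCK.
suff: toC (l * (f *m f^T) 0 0) <= toC ((f *m A *m f^T) 0 0) by rewrite lecR.
have -> x y : toC (x * y) = toC x * toC y by exact: rmorphM.
rewrite normE quadE mulr_sumr; apply: ler_sum => i _.
have [->|gi0] := eqVneq (g 0 i) 0; first by rewrite normr0 expr0n /= !mulr0.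
apply: ler_wpM2r; first by rewrite exprn_ge0.
have [k spk] := spreal i; rewrite spk lecR.
have eigC j : \sum_a P i a * toC (A a j) = toC k * P i j.
  have /matrixP/(_ i j) := PA; rewrite mul_diag_mx !mxE spk => <-.
  by apply: eq_bigr => a _; rewrite [in RHS]mxE.
pose h := \sum_j P i j * toC (f 0 j).
have h0 : h != 0.
  have -> : h = g^t* i 0 by rewrite gtE mxE; apply: eq_bigr => j _; rewrite !mxE.
  by rewrite !mxE conjC_eq0.
(* [c] stands for the real or the imaginary part. *)
have key (c : R[i] -> R) : {morph c : x y / x + y} -> c 0 = 0 ->
    (forall x a, c (x * toC a) = c x * a) -> c h != 0 -> l <= k.
  move=> cD c0 cM ch0; pose u := \row_j c (P i j).
  have uA : u *m A = k *: u.
    apply/rowP=> j; rewrite !mxE [RHS]mulrC -cM [_ * toC k]mulrC -eigC.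
    rewrite (big_morph c cD c0); apply: eq_bigr => a _; rewrite mxE cM //.
  have uf : (u *m f^T) 0 0 = c h.
    rewrite mxE (big_morph c cD c0); apply: eq_bigr => j _.
    by rewrite !mxE cM.
  apply: minl.
    apply/eigenvalueP; exists u => //; apply: contraNneq ch0 => u0.
    by rewrite -uf u0 mul0mx mxE.
  apply: contraNneq ch0 => k0; rewrite -uf; apply/eqP/kerf.
  by rewrite uA k0 scale0r.
have [Re0|] := eqVneq (complex.Re h) 0; last first.
  by apply: (key (@complex.Re R)) => [[? ?] [? ?]||[? ?] ?] //=; rewrite mulr0 subr0.
apply: (key (@complex.Im R)) => [[? ?] [? ?]||[? ?] ?|] //=.
  by rewrite mulr0 add0r mulrC.
by apply: contraNneq h0 => Im0; rewrite (complexE h) Re0 Im0 mulr0 addr0.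
Qed.

End SymmetricRayleigh.

Section Energy.
Variables (R : realType) (G : mgraph).
Implicit Types f : vertex G -> R.

Definition energy f : R := \sum_(e : edge G) (f (ends e).1 - f (ends e).2) ^+ 2.

Definition row_of f : 'rV[R]_#|vertex G| := \row_i f (enum_val i).

Lemma row_ofK (v : 'rV[R]_#|vertex G|) : row_of (fun x => v 0 (enum_rank x)) = v.
Proof. by apply/rowP => i; rewrite mxE enum_valK. Qed.

Lemma sum_enum_val f : \sum_(i < #|vertex G|) f (enum_val i) = \sum_x f x.
Proof. by rewrite [RHS](reindex _ (onW_bij _ (@enum_val_bij _))). Qed.

Lemma row_of_dot f g : (row_of f *m (row_of g)^T) 0 0 = \sum_x f x * g x.
Proof.
rewrite -(sum_enum_val (fun x => f x * g x)) mxE.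
by apply: eq_bigr => i _; rewrite !mxE.
Qed.

Lemma adjacency_numberE (x y : vertex G) :
  adjacency_number x y = (\sum_(e : edge G) ((ends e == (x, y)) + (ends e == (y, x))))%N.
Proof.
rewrite /adjacency_number cardsE -sum1_card big_distrl /= big_mkcond /=.
apply: eq_bigr => e _; rewrite unfold_in /joins mul1n.
have [<-|xy] := eqVneq x y; first by case: eqP.
by case: eqP => [->|_]; case: eqP => // -[xy']; rewrite xy' eqxx in xy.
Qed.

(** The Laplacian is the sum over the edges of the products of the signed
    incidence vectors with themselves; a loop contributes 0, its two units of
    degree cancelling against the doubled adjacency. *)
Lemma laplacianE i j :
  laplacian R G i j = \sum_(e : edge G)
    (((ends e).1 == enum_val i)%:R - ((ends e).2 == enum_val i)%:R) *
    (((ends e).1 == enum_val j)%:R - ((ends e).2 == enum_val j)%:R).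
Proof.
rewrite !mxE adjacency_numberE /degree !natr_sum -sumrMnl -sumrB.
apply: eq_bigr => e _; rewrite -(inj_eq enum_val_inj).
case: (ends e) => a b /=; rewrite !xpair_eqE.
set x := enum_val i; set y := enum_val j.
have [<-|xy] := eqVneq x y; first by do 2!case: eqP => _; rewrite ?mulr1n /=; ring.
have [->|ax] := eqVneq a x; have [->|bx] := eqVneq b x;
  rewrite ?(negbTE xy) ?mulr0n /=; do ?case: eqP => _ /=; ring.
Qed.

Lemma laplacian_sym : (laplacian R G)^T = laplacian R G.
Proof.
apply/matrixP => i j; rewrite mxE !laplacianE.
by apply: eq_bigr => e _; rewrite mulrC.
Qed.

Lemma laplacian_energy f :
  (row_of f *m laplacian R G *m (row_of f)^T) 0 0 = energy f.
Proof.
pose b (e : edge G) x : R := ((ends e).1 == x)%:R - ((ends e).2 == x)%:R.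
have bE e : \sum_x f x * b e x = f (ends e).1 - f (ends e).2.
  have pick a : \sum_x f x * (a == x)%:R = f a.
    rewrite (bigD1 a) //= eqxx mulr1 big1 ?addr0 // => x.
    by rewrite eq_sym => /negbTE ->; rewrite mulr0.
  by under eq_bigr do rewrite mulrBr; rewrite sumrB !pick.
have LE j : (row_of f *m laplacian R G) 0 j =
    \sum_e (f (ends e).1 - f (ends e).2) * b e (enum_val j).
  rewrite mxE; under eq_bigr => i _ do rewrite laplacianE mulr_sumr mxE.
  rewrite exchange_big /=; apply: eq_bigr => e _.
  rewrite -bE -(sum_enum_val (fun x => f x * b e x)) mulr_suml.
  by apply: eq_bigr => i _; rewrite mulrA.
rewrite mxE; under eq_bigr => j _ do rewrite LE mulr_suml !mxE.
rewrite exchange_big /=; apply: eq_bigr => e _.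
rewrite expr2 -{3}bE -(sum_enum_val (fun x => f x * b e x)) mulr_sumr.
by apply: eq_bigr => i _; rewrite -mulrA (mulrC (b _ _)).
Qed.

Lemma handshake (F : vertex G -> R) :
  \sum_(e : edge G) (F (ends e).1 + F (ends e).2) = \sum_x F x *+ degree x.
Proof.
have pick a : F a = \sum_x F x *+ (a == x).
  by rewrite (bigD1 a) //= eqxx big1 ?addr0 // => x; rewrite eq_sym => /negbTE ->.
under eq_bigr do rewrite pick [F (ends _).2]pick -big_split /=.
rewrite exchange_big /=; apply: eq_bigr => x _; rewrite /degree -sumrMnr.
by apply: eq_bigr => e _; rewrite mulrnDr.
Qed.

Lemma energy_le f : energy f <= 2 * (max_degree G)%:R * \sum_x f x ^+ 2.
Proof.
apply: (@le_trans _ _ (2 * \sum_(e : edge G) (f (ends e).1 ^+ 2 + f (ends e).2 ^+ 2))).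
  rewrite mulr_sumr; apply: ler_sum => e _.
  by have := sqr_ge0 (f (ends e).1 + f (ends e).2); nra.
rewrite (handshake (fun x => f x ^+ 2)) -mulrA; apply: ler_wpM2l => //; rewrite mulr_sumr.
apply: ler_sum => x _; rewrite -(mulr_natl (f x ^+ 2)).
apply: ler_wpM2r; rewrite ?sqr_ge0 // ler_nat.
exact: leq_bigmax.
Qed.

Lemma energy_ge0 f : 0 <= energy f.
Proof. by apply: sumr_ge0 => e _; apply: sqr_ge0. Qed.

(** The Rayleigh quotient of an eigenvector is its eigenvalue. *)
Lemma laplacian_eigenvalue_bounds l :
  eigenvalue (laplacian R G) l -> 0 <= l <= 2 * (max_degree G)%:R.
Proof.
case/eigenvalueP => v vL v0; pose f x := v 0 (enum_rank x).
have lE : l * \sum_x f x ^+ 2 = energy f.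
  rewrite -laplacian_energy row_ofK vL -scalemxAl mxE -{1}(row_ofK v) -/f.
  by rewrite -[v in v^T]row_ofK row_of_dot; under eq_bigr do rewrite expr2.
have f2ge0 : 0 <= \sum_x f x ^+ 2 by apply: sumr_ge0 => x _; exact: sqr_ge0.
have f2 : 0 < \sum_x f x ^+ 2.
  rewrite lt_def f2ge0 andbT; apply: contraNneq v0 => /eqP.
  rewrite psumr_eq0 => [/allP z|x _]; last exact: sqr_ge0.
  apply/eqP/rowP => i; rewrite mxE.
  have := z (enum_val i); rewrite mem_index_enum sqrf_eq0 /f enum_valK.
  by move/(_ isT)/eqP.
rewrite -(pmulr_lge0 l f2) lE energy_ge0 /=.
by rewrite -(ler_pM2r f2) lE energy_le.
Qed.

Lemma energy_eq0 f : connected G -> energy f = 0 -> forall x y, f x = f y.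
Proof.
case/andP=> _ /forallP conn /eqP.
rewrite psumr_eq0 => [/allP z|e _]; last exact: sqr_ge0.
have adj x y : adjacent x y -> f x = f y.
  case/existsP=> e; have := z e; rewrite mem_index_enum sqrf_eq0 subr_eq0.
  by move/(_ isT)/eqP => fe /orP[] /eqP E; rewrite E in fe.
move=> x y; have /connectP[p] := forallP (conn x) y.
elim: p x {conn} => [|z' p IHp] x /= => [_ ->//|/andP[/adj -> pp] yE].
exact: IHp.
Qed.

(** On a connected graph the kernel consists of the constants, and these are
    orthogonal to any [f] of sum 0. *)
Lemma lambda_rayleigh l f :
    connected G ->
    (forall mu, eigenvalue (laplacian R G) mu -> mu != 0 -> l <= mu) ->
    \sum_x f x = 0 ->
  l * \sum_x f x ^+ 2 <= energy f.
Proof.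
move=> conn minl f0; rewrite -laplacian_energy.
have -> : \sum_x f x ^+ 2 = (row_of f *m (row_of f)^T) 0 0.
  by rewrite row_of_dot; under eq_bigr do rewrite expr2.
apply: symmetric_rayleigh => // [|v vL]; first exact: laplacian_sym.
pose g x := v 0 (enum_rank x); have gconst : forall x y, g x = g y.
  apply: energy_eq0 => //.
  by rewrite -laplacian_energy row_ofK vL mul0mx mxE.
rewrite -(row_ofK v) (row_of_dot g f); case/andP: conn => /card_gt0P[r _] _.
by under eq_bigr => x _ do rewrite (gconst x r); rewrite -mulr_sumr f0 mulr0.
Qed.

End Energy.

(** * The eigenvalue of a graph against the degree over a tree *)

(** The test function is [b] on the [a] vertices of the first side, [- a] on the
    [b] vertices of the second and 0 on the separator.  A crossing edge has
    energy [(a + b) ^+ 2]; any other edge with non-zero energy has an end in the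
    separator, and its energy is [a ^+ 2] or [b ^+ 2]. *)
Lemma cut_rayleigh (R : realType) (G : mgraph) (l : R) (c : vertex G -> option bool)
    (a := (\sum_x (c x == Some true))%:R : R) (b := (\sum_x (c x == Some false))%:R) :
    connected G ->
    (forall mu, eigenvalue (laplacian R G) mu -> mu != 0 -> l <= mu) ->
  l * (a * b * (a + b)) <= (cut_size c)%:R * (a + b) ^+ 2
    + (separator_size c)%:R * (max_degree G)%:R * (a ^+ 2 + b ^+ 2).
Proof.
move=> conn minl.
pose f x := if c x is Some s then if s then b else - a else 0.
have aE : a = \sum_x (c x == Some true)%:R by rewrite /a natr_sum.
have bE : b = \sum_x (c x == Some false)%:R by rewrite /b natr_sum.
have [a0 b0] : 0 <= a /\ 0 <= b by rewrite /a /b !ler0n.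
have f0 : \sum_x f x = 0.
  transitivity (\sum_x ((c x == Some true)%:R * b - (c x == Some false)%:R * a)).
    by apply: eq_bigr => x _; rewrite /f; case: (c x) => [[]|] /=; ring.
  by rewrite sumrB -!mulr_suml -aE -bE mulrC subrr.
have f2 : \sum_x f x ^+ 2 = a * b * (a + b).
  transitivity (\sum_x ((c x == Some true)%:R * b ^+ 2 + (c x == Some false)%:R * a ^+ 2)).
    by apply: eq_bigr => x _; rewrite /f; case: (c x) => [[]|] /=; ring.
  rewrite big_split /= -!mulr_suml -aE -bE; ring.
rewrite -f2; apply: le_trans (lambda_rayleigh conn minl f0) _.
pose N x : R := (c x == None)%:R.
apply: (@le_trans _ _ (\sum_(e : edge G) ((crosses (c (ends e).1) (c (ends e).2))%:R
    * (a + b) ^+ 2 + (N (ends e).1 + N (ends e).2) * (a ^+ 2 + b ^+ 2)))).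
  apply: ler_sum => e _; rewrite /f /N /crosses.
  by case: (c (ends e).1) => [[]|]; case: (c (ends e).2) => [[]|] /=; nra.
rewrite big_split /= -!mulr_suml -natr_sum lerD2l; apply: ler_wpM2r.
  by rewrite addr_ge0 ?sqr_ge0.
rewrite handshake natr_sum mulr_suml; apply: ler_sum => x _.
rewrite /N -(mulr_natr _ (degree x)); apply: ler_wpM2l; rewrite ?ler0n // ler_nat.
exact: leq_bigmax.
Qed.

(** The case 0 is the default value taken when no smallest non-zero eigenvalue
    exists; the bound to be proved is then trivial. *)
Lemma lambda_cases (R : realType) (G : mgraph) :
  lambda R G = 0 \/ eigenvalue (laplacian R G) (lambda R G) /\
    forall mu, eigenvalue (laplacian R G) mu -> mu != 0 -> lambda R G <= mu.
Proof. by rewrite /lambda; case: xgetP => [l _ [eig _ minl]|_]; [right|left]. Qed.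

Lemma sgon_attained G : refined_tree_degree G (sgon G).
Proof.
rewrite /sgon; case: xgetP => [d _ []//|none].
have [d0] := refined_tree_degree_exists G; move/asboolP => d0P.
have [] := ex_minnP (P := fun d => `[< refined_tree_degree G d >]) (ex_intro _ d0 d0P).
move=> d /asboolP dP dmin; case: (none d); split=> // d' /asboolP; exact: dmin.
Qed.

Lemma max_degree_gt0 (G : mgraph) :
  no_isolated G -> (0 < #|vertex G|)%N -> (0 < max_degree G)%N.
Proof.
move=> iso /card_gt0P[v _]; apply: leq_trans (leq_bigmax v).
have [e inc] := iso v; rewrite /degree (bigD1 e) //= !(eq_sym _ v).
by case/orP: inc => ->; rewrite ?addn1 ?add1n ?addnS ?addSn.
Qed.

(** Dividing by [a * b], balance bounds [(a ^+ 2 + b ^+ 2) / (a * b)] by 10/3 and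
    [(a + b) ^+ 2 / (a * b)] by 16/3; both fit below [4 * (D + 1)] per vertex or
    edge cut, as [D] is at least 1. *)
Lemma balanced_cut_arith (R : realFieldType) (l a b k s d D : R) :
    0 <= l -> 0 <= k -> 0 <= s -> 1 <= D -> 0 < a * b ->
    a <= 3 * b -> b <= 3 * a -> k + s <= d ->
    l * (a * b * (a + b)) <= k * (a + b) ^+ 2 + s * D * (a ^+ 2 + b ^+ 2) ->
  l * (a + b + s - d) <= 4 * d * (D + 1).
Proof.
move=> l0 k0 s0 D1 ab tf ft kd ray.
have bal : 3 * (a ^+ 2 + b ^+ 2) <= 10 * (a * b) by nra.
have sD : 0 <= s * D by rewrite mulr_ge0; lra.
have ray' : (a * b) * (3 * (l * (a + b))) <= (a * b) * (16 * k + 10 * (s * D)).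
  have : 0 <= k * (10 * (a * b) - 3 * (a ^+ 2 + b ^+ 2)) by rewrite mulr_ge0; lra.
  have : 0 <= s * D * (10 * (a * b) - 3 * (a ^+ 2 + b ^+ 2)) by rewrite mulr_ge0; lra.
  lra.
move: ray'; rewrite (ler_pM2l ab) => ray'.
have : 0 <= l * (d - s) by rewrite mulr_ge0; lra.
have : 0 <= (D - 1) * k by rewrite mulr_ge0; lra.
have : 0 <= (D + 1) * (d - k - s) by rewrite mulr_ge0; lra.
lra.
Qed.

(** When [3 * d >= n], the bound [l <= 2 * D] alone suffices; otherwise the tree
    provides a balanced cut of size at most [d], to be tested against [l]. *)
Lemma eigenvalue_le_degree (R : realType) (G : mgraph) (l : R) d :
    connected G -> (1 < #|vertex G|)%N ->
    eigenvalue (laplacian R G) l ->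
    (forall mu, eigenvalue (laplacian R G) mu -> mu != 0 -> l <= mu) ->
    refined_tree_degree G d ->
  l * (#|vertex G|%:R - d%:R) <= 4 * d%:R * ((max_degree G)%:R + 1).
Proof.
move=> conn card eig minl deg.
have /andP[l0 l2] := laplacian_eigenvalue_bounds eig.
move: l2; set n := #|vertex G|; set D := max_degree G => l2.
have D0 : 0 <= D%:R :> R := ler0n _ _; have d0 : 0 <= d%:R :> R := ler0n _ _.
have [big|small] := leqP n (3 * d)%N.
  have : n%:R <= 3 * d%:R :> R by rewrite -natrM ler_nat.
  nra.
have [c [kd tf ft]] := refined_tree_degree_cut (connected_no_isolated conn card) deg small.
have := cut_rayleigh c conn minl; rewrite -/D => ray.
(* Every vertex is on one of the two sides or in the separator. *)
have nE : (n = \sum_x (c x == Some true) + \sum_x (c x == Some false) + separator_size c)%N.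
  rewrite -!big_split /= /n -sum1_card; apply: eq_bigr => x _.
  by case: (c x) => [[]|].
move: nE kd tf ft; set a := (\sum_x (c x == Some true))%N.
set b := (\sum_x (c x == Some false))%N; set k := cut_size c; set s := separator_size c.
move=> nE kd tf ft.
have ab : (0 < a * b)%N by rewrite muln_gt0; lia.
have {}tf : a%:R <= 3 * b%:R :> R by rewrite -natrM ler_nat.
have {}ft : b%:R <= 3 * a%:R :> R by rewrite -natrM ler_nat.
have {}kd : k%:R + s%:R <= d%:R :> R by rewrite -natrD ler_nat.
have {}nE : n%:R = a%:R + b%:R + s%:R :> R by rewrite nE !natrD.
have {}ab : 0 < a%:R * b%:R :> R by rewrite -natrM ltr0n.
have D1 : 1 <= D%:R :> R.
  rewrite ler1n max_degree_gt0 ?(ltnW card) //; exact: connected_no_isolated.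
by rewrite nE; apply: balanced_cut_arith (ray) => //; rewrite ?ler0n.
Qed.

Theorem theorem3 (R : realType) (G : mgraph)
    (hconn : connected G) (hcard : (1 < #|vertex G|)%N) :
  Num.ceil (lambda R G / (lambda R G + 4 * ((max_degree G)%:R + 1))
            * (#|vertex G|)%:R)
  <= (sgon G)%:Z.
Proof.
rewrite real_ceil_le_int ?num_real // -pmulrn.
have [->|[eig minl]] := lambda_cases R G; first by rewrite !mul0r ler0n.
have /andP[l0 _] := laplacian_eigenvalue_bounds eig.
have main := eigenvalue_le_degree hconn hcard eig minl (sgon_attained G).
have D0 : 0 <= (max_degree G)%:R :> R := ler0n _ _.
rewrite mulrAC ler_pdivrMr; lra.
Qed.
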